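(* Let $\{|\psi_\mu\rangle\}_{\mu=1}^6=\{|+\rangle|1\rangle|0\rangle,\ |0\rangle|+\rangle|1\rangle,\ |1\rangle|0\rangle|+\rangle,\ |-\rangle|1\rangle|0\rangle,\ |0\rangle|-\rangle|1\rangle,\ |1\rangle|0\rangle|-\rangle\}$, let the label $\mu$ be uniformly distributed on $\{1,\dots,6\}$, and let $\boldsymbol a$ be the record of all measurement outcomes obtained by applying a stabilizer operation to the input $|\psi_\mu\rangle$. Then for every stabilizer operation $$I(\mu:\boldsymbol a)\le \log_2 6-\tfrac13,$$ equivalently $H(\mu|\boldsymbol a)=H(\mu)-I(\mu:\boldsymbol a)\ge\tfrac13$. Consequently, the probability of correctly guessing $\mu$ from $\boldsymbol a$ satisfies $p^{\rm STAB}_{\rm succ}<0.9603$ for every stabilizer operation.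
   Context: Here $|0\rangle,|1\rangle$ is the computational basis of $\mathbb{C}^2$, $|\pm\rangle=\frac{1}{\sqrt2}(|0\rangle\pm|1\rangle)$, and juxtaposition denotes tensor product. $H(x)=-\sum_x p(x)\log_2p(x)$ is the Shannon entropy and $I(\mu:\boldsymbol a)=H(\mu)+H(\boldsymbol a)-H(\mu\boldsymbol a)$ is the mutual information of the joint distribution $p(\mu,\boldsymbol a)=\frac16\,p(\boldsymbol a|\mu)$, where $p(\boldsymbol a|\mu)$ is the probability of record $\boldsymbol a$ on input $|\psi_\mu\rangle$. The guess is a function $g$ of the record $\boldsymbol a$, and $p^{\rm STAB}_{\rm succ}=\Pr[g(\boldsymbol a)=\mu]$. Pauli and Clifford groups: $X,Y,Z$ are the single-qubit Pauli matrices; $\mathcal{P}_n=\langle X,Y,Z\rangle^{\otimes n}$ is the $n$-qubit Pauli group; the Clifford group is $\mathrm{Cl}_n=\{V\in U(2^n): V\mathcal{P}_nV^\dagger=\mathcal{P}_n\}$. Stabilizer operations: a stabilizer operation is a finite, arbitrarily long sequence of steps, each of one of the following kinds: (1) appending ancillary qubits in computational basis states; (2) applying a Clifford unitary to the qubits currently present; (3) performing a projective measurement of a qubit in the computational basis. The choice of each step may depend adaptively on all previous measurement outcomes. *)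

(* Defs.v *)
From HB Require Import structures.
From mathcomp Require Import all_boot all_order all_algebra.
From mathcomp Require Import spectral.
From mathcomp Require Import complex mxtens.
From mathcomp Require Import boolp classical_sets reals exp.

Set Implicit Arguments.
Unset Strict Implicit.
Unset Printing Implicit Defensive.

Import Order.TTheory GRing.Theory Num.Theory.

Local Open Scope classical_set_scope.
Local Open Scope ring_scope.
Local Open Scope complex_scope.
Local Open Scope sesquilinear_scope.

Section Qubits.
Variable R : realType.
Local Notation C := R[i].

(* Kronecker products are right-nested, so the first tensor factor is the most
   significant bit of a basis index in 'I_(2 ^ n). *)
Fixpoint tensor n : ('I_n -> 'M[C]_2) -> 'M[C]_(2 ^ n) :=
  match n with
  | 0 => fun _ => 1%:M
  | m.+1 => fun A =>
      castmx (esym (expnS 2 m), esym (expnS 2 m))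
        (A ord0 *t tensor (fun j : 'I_m => A (lift ord0 j)))
  end.

Definition ket (b : 'I_2) : 'cV[C]_2 := delta_mx b 0.
Definition ket_plus : 'cV[C]_2 := (Num.sqrt (2 : R))^-1%:C *: (ket 0 + ket 1).
Definition ket_minus : 'cV[C]_2 := (Num.sqrt (2 : R))^-1%:C *: (ket 0 - ket 1).

Definition pauliX : 'M[C]_2 := delta_mx 0 1 + delta_mx 1 0.
Definition pauliY : 'M[C]_2 := - 'i *: delta_mx 0 1 + 'i *: delta_mx 1 0.
Definition pauliZ : 'M[C]_2 := delta_mx 0 0 - delta_mx 1 1.

Inductive pauli1 : 'M[C]_2 -> Prop :=
| pauli1_X : pauli1 pauliX
| pauli1_Y : pauli1 pauliY
| pauli1_Z : pauli1 pauliZ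
| pauli1_1 : pauli1 1%:M
| pauli1_M A B : pauli1 A -> pauli1 B -> pauli1 (A *m B)
| pauli1_V A : pauli1 A -> pauli1 (invmx A).

Definition pauli n : set 'M[C]_(2 ^ n) :=
  [set tensor A | A in [set A : 'I_n -> 'M[C]_2 | forall i, pauli1 (A i)]].

Definition clifford n : set 'M[C]_(2 ^ n) :=
  [set V | V \is unitarymx /\
           [set V *m P *m V^t* | P in @pauli n] = @pauli n].

(* The new qubit becomes the first tensor factor. Nothing is lost: Clifford
   unitaries include the permutations of the qubits. *)
Definition append n (b : 'I_2) (v : 'cV[C]_(2 ^ n)) : 'cV[C]_(2 ^ n.+1) :=
  castmx (esym (expnS 2 n), erefl) (ket b *t v).

Definition proj n (i : 'I_n) (b : 'I_2) : 'M[C]_(2 ^ n) :=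
  tensor (fun j => if j == i then delta_mx b b else 1%:M).

(* A stabilizer operation on a register of n qubits, as an adaptive protocol
   tree: what follows a measurement is a function of its outcome. Branching is
   finite, so every such tree has finite depth. *)
Inductive stabop : nat -> Type :=
| Stop n : stabop n
| Append n (b : 'I_2) (o : stabop n.+1) : stabop n
| Apply n (V : 'M[C]_(2 ^ n)) (hV : clifford V) (o : stabop n) : stabop n
| Measure n (i : 'I_n) (f : 'I_2 -> stabop n) : stabop n.

(* A record is the sequence of all outcomes met along one run of the protocol:
   the first outcome b, then a record of the protocol that follows b. *)
Fixpoint record n (o : stabop n) : finType :=
  match o with
  | Stop _ => unit
  | Append _ _ o' => record o'
  | Apply _ _ _ o' => record o'
  | Measure _ _ f => {b : 'I_2 & record (f b)}
  end.

(* Post-measurement states are left unnormalized, so that the final squared norm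
   is the product of the conditional Born probabilities of the outcomes. *)
Fixpoint record_prob n (o : stabop n) {struct o} :
    'cV[C]_(2 ^ n) -> record o -> R :=
  match o in stabop n return 'cV[C]_(2 ^ n) -> record o -> R with
  | Stop _ => fun v _ => \sum_x complex.Re (`|v x 0| ^+ 2)
  | Append _ b o' => fun v => @record_prob _ o' (append b v)
  | Apply _ V _ o' => fun v => @record_prob _ o' (V *m v)
  | Measure _ i f => fun v a =>
      @record_prob _ (f (tag a)) (proj i (tag a) *m v) (tagged a)
  end.

Definition psi (mu : 'I_6) : 'cV[C]_(2 ^ 3) :=
  nth 0 [:: ket_plus *t (ket 1 *t ket 0) : 'cV[C]_(2 ^ 3);
            ket 0 *t (ket_plus *t ket 1);
            ket 1 *t (ket 0 *t ket_plus);
            ket_minus *t (ket 1 *t ket 0);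
            ket 0 *t (ket_minus *t ket 1);
            ket 1 *t (ket 0 *t ket_minus)] mu.

Definition joint (o : stabop 3) (x : 'I_6 * record o) : R :=
  6^-1 * record_prob (psi x.1) x.2.

(* The probability that the guess g, made from the record, is the label. *)
Definition psucc (o : stabop 3) (g : record o -> 'I_6) : R :=
  \sum_(x : 'I_6 * record o | g x.2 == x.1) joint x.

End Qubits.

Arguments joint {R} o x.
Arguments psucc {R} o g.

Section Entropy.
Variable R : realType.

Definition log2 (x : R) : R := ln x / ln 2.

Definition entropy (T : finType) (p : T -> R) : R :=
  - \sum_x p x * log2 (p x).

Variables S T : finType.
Implicit Type p : S * T -> R.

Definition marginal1 p (s : S) : R := \sum_t p (s, t).
Definition marginal2 p (t : T) : R := \sum_s p (s, t).

Definition mutual_info p : R :=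
  entropy (marginal1 p) + entropy (marginal2 p) - entropy p.

(* Entropy of the first variable given the second. *)
Definition cond_entropy p : R := entropy (marginal1 p) - mutual_info p.

End Entropy.

(* Main.v *)
Require Import Defs.
From mathcomp Require Import all_boot all_order all_algebra.
From mathcomp Require Import reals.
From mathcomp Require Import spectral complex mxtens boolp exp ring lra.

(* For every stabilizer operation and every guess g of the label from the
   record, psucc <= 5/6; Hellman and Raviv's inequality
   H(mu|a) >= 2 (1 - max_g psucc) then yields the entropy bound 1/3.

   To bound psucc, follow the Kraus operator K along a run. As long as nothing
   has been learnt about the input, K is a multiple of an isometry, and every
   Pauli Q either satisfies Q K = c K S for some three-qubit Pauli S or has
   K^* Q K = 0. Measuring Z with Z K = c K S and S nontrivial is the first
   measurement to reveal anything: it measures S on the input. Let A be the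
   Kraus operator of a whole run through this measurement; then c A S = +-A.
   - If S is Z on qubit j, it exchanges the two states with |+-> on qubit j,
     which therefore have the same probability of giving the record: one of
     them can be dropped from the guesses, leaving total weight 5.
   - Otherwise <psi|S|psi> = 0 for all mu outside a single pair of states that
     differ by the sign of |+->, so psi and S psi are orthonormal, have the same
     probability, and by Bessel's inequality this probability is at most
     tr(A^* A) / 2. Summing over the records, guessing is again bounded by
     8 / 2 + (1 + 1) / 2 = 5. *)

Set Implicit Arguments.
Unset Strict Implicit.
Unset Printing Implicit Defensive.

Import Order.TTheory GRing.Theory Num.Theory.

Local Open Scope ring_scope.
Local Open Scope complex_scope.
Local Open Scope sesquilinear_scope.

(** * Adjoints, and Bessel's inequality as a matrix identity *)

Section Adjoint.
Variable C : numClosedFieldType.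

Lemma adjmxM m n p (A : 'M[C]_(m, n)) (B : 'M_(n, p)) :
  (A *m B)^t* = B^t* *m A^t*.
Proof. by rewrite trmx_mul map_mxM. Qed.

Lemma adjmxZ m n (c : C) (A : 'M[C]_(m, n)) : (c *: A)^t* = c^* *: A^t*.
Proof. by rewrite linearZ /= map_mxZ. Qed.

Lemma adjmxD m n (A B : 'M[C]_(m, n)) : (A + B)^t* = A^t* + B^t*.
Proof. by rewrite linearD /= map_mxD. Qed.

Lemma adjmx_tens m n p q (A : 'M[C]_(m, n)) (B : 'M[C]_(p, q)) :
  (A *t B)^t* = A^t* *t B^t*.
Proof. by rewrite trmx_tens map_mxT. Qed.

(** [P = W W^t*] is an orthogonal projector because the columns of [W] are orthonormal; the witness
    is [A (1 - P)], the part of [A] that [W] misses. *)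
Lemma bessel_residual m n k (A : 'M[C]_(m, n)) (W : 'M[C]_(n, k)) :
  W^t* *m W = 1%:M ->
  exists B : 'M[C]_(m, n), A *m A^t* = B *m B^t* + A *m W *m (A *m W)^t*.
Proof.
move=> WW; pose P : 'M[C]_n := W *m W^t*.
have PP : P *m P = P by rewrite /P mulmxA -(mulmxA W) WW mulmx1.
have PH : P^t* = P by rewrite adjmxM trmxCK.
pose Q : 'M[C]_n := 1%:M - P.
have QQ : Q *m Q = Q.
  by rewrite /Q mulmxBl mul1mx mulmxBr mulmx1 PP subrr subr0.
have QH : Q^t* = Q by rewrite linearB /= map_mxB PH trmx1 map_mx1.
exists (A *m Q); rewrite !adjmxM QH !mulmxA.
by rewrite -[A *m Q *m Q]mulmxA QQ mulmxBr mulmx1 mulmxBl /P !mulmxA subrK.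
Qed.

End Adjoint.

(** * The squared Frobenius norm *)

Section Frobenius.
Variable R : realType.
Local Notation C := R[i].

(** One notion serves both for unnormalized states, where it is the Born probability, and for Kraus
    operators, where it is the trace of [A^t* A]. Taking real parts puts its values in [R]. *)
Definition sqfrob m n (A : 'M[C]_(m, n)) : R :=
  \sum_i \sum_j complex.Re (`|A i j| ^+ 2).

Lemma sqfrob_ge0 m n (A : 'M[C]_(m, n)) : 0 <= sqfrob A.
Proof.
apply: sumr_ge0 => i _; apply: sumr_ge0 => j _.
by rewrite -add_Re2_Im2 /= addr_ge0 ?sqr_ge0.
Qed.

Lemma sqfrobE m n (A : 'M[C]_(m, n)) : sqfrob A = complex.Re (\tr (A *m A^t*)).
Proof.
rewrite /sqfrob /mxtrace raddf_sum; apply: eq_bigr => i _.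
rewrite mxE raddf_sum; apply: eq_bigr => j _.
by rewrite !mxE normCK.
Qed.

Lemma sqfrobE_adj m n (A : 'M[C]_(m, n)) : sqfrob A = complex.Re
  (\tr (A^t* *m A)).
Proof. by rewrite mxtrace_mulC sqfrobE. Qed.

(** Turns the norm of a Kraus operator into a sum of probabilities over basis inputs, to which total
    probability applies. *)
Lemma sqfrob_cols m n (A : 'M[C]_(m, n)) :
  sqfrob A = \sum_x sqfrob (A *m delta_mx x 0 : 'cV_m).
Proof.
rewrite /sqfrob exchange_big; apply: eq_bigr => x _; apply: eq_bigr => i _.
by rewrite big_ord1 -colE mxE.
Qed.

Lemma sqfrobZ m n (c : C) (A : 'M[C]_(m, n)) :
  sqfrob (c *: A) = complex.Re (`|c| ^+ 2) * sqfrob A.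
Proof.
rewrite /sqfrob mulr_sumr; apply: eq_bigr => i _; rewrite mulr_sumr.
apply: eq_bigr => j _; rewrite mxE normrM exprMn -!add_Re2_Im2 /=; ring.
Qed.

Lemma sqfrobZ1 m n (c : C) (A : 'M[C]_(m, n)) : `|c| = 1 -> sqfrob (c *: A) =
  sqfrob A.
Proof. by move=> c1; rewrite sqfrobZ c1 expr1n mul1r. Qed.

Lemma sqfrob_mul_scalar m n p (w : R) (K : 'M[C]_(m, n)) (v : 'M[C]_(n, p)) :
  K^t* *m K = w%:C%:M -> sqfrob (K *m v) = w * sqfrob v.
Proof.
move=> hK; rewrite !sqfrobE_adj adjmxM -mulmxA (mulmxA _ K) hK mul_scalar_mx.
by rewrite -scalemxAr mxtraceZ; case: (\tr _) => a b /=; ring.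
Qed.

Lemma bessel m n k (A : 'M[C]_(m, n)) (W : 'M[C]_(n, k)) :
  W^t* *m W = 1%:M -> sqfrob (A *m W) <= sqfrob A.
Proof.
move=> /(bessel_residual A)[B hB].
by rewrite [sqfrob A]sqfrobE hB mxtraceD raddfD /= -!sqfrobE lerDr sqfrob_ge0.
Qed.

Lemma bessel2 m n (A : 'M[C]_(m, n)) (u v : 'cV[C]_n) :
  u^t* *m u = 1%:M -> v^t* *m v = 1%:M -> u^t* *m v = 0 ->
  sqfrob (A *m u) + sqfrob (A *m v) <= sqfrob A.
Proof.
move=> uu vv uv.
have vu : v^t* *m u = 0.
  by rewrite -[LHS]trmxCK adjmxM trmxCK uv trmx0 map_mx0.
have -> : sqfrob (A *m u) + sqfrob (A *m v) = sqfrob (A *m row_mx u v).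
  rewrite mul_mx_row /sqfrob -big_split; apply: eq_bigr => i _.
  rewrite big_split_ord /=.
  by congr (_ + _); apply: eq_bigr => j _; rewrite ?row_mxEl ?row_mxEr.
by apply: bessel; rewrite tr_row_mx map_col_mx mul_col_row uu vv uv vu
  -scalar_mx_block.
Qed.

End Frobenius.

(** * Kronecker products and single-qubit Pauli matrices *)

Section Tensor.
Variable R : realType.
Local Notation C := R[i].

Lemma castmx_sqM (T : pzRingType) m m' (e : m = m') (A B : 'M[T]_m) :
  castmx (e, e) A *m castmx (e, e) B = castmx (e, e) (A *m B).
Proof. by case: m' / e; rewrite !castmx_id. Qed.

Lemma adjmx_cast m n m' n' (e : (m = m') * (n = n')) (A : 'M[C]_(m, n)) :
  (castmx e A)^t* = castmx (e.2, e.1) (A^t*).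
Proof. by case: e => em en; case: m' / em; case: n' / en; rewrite !castmx_id.
  Qed.

Lemma castmxD (V : nmodType) m n m' n' (e : (m = m') * (n = n'))
  (A B : 'M[V]_(m, n)) :
  castmx e (A + B) = castmx e A + castmx e B.
Proof. by case: e => em en; case: m' / em; case: n' / en; rewrite !castmx_id.
  Qed.

Lemma castmxZ (T : pzRingType) m n m' n' (e : (m = m') * (n = n')) (c : T)
  (A : 'M[T]_(m, n)) :
  castmx e (c *: A) = c *: castmx e A.
Proof. by case: e => em en; case: m' / em; case: n' / en; rewrite !castmx_id.
  Qed.

Lemma tensmxZl m n p q (c : C) (A : 'M[C]_(m, n)) (B : 'M[C]_(p, q)) :
  (c *: A) *t B = c *: (A *t B).
Proof. by apply/matrixP => i j; rewrite !mxE mulrA. Qed.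

Lemma tensmxZr m n p q (c : C) (A : 'M[C]_(m, n)) (B : 'M[C]_(p, q)) :
  A *t (c *: B) = c *: (A *t B).
Proof. by apply/matrixP => i j; rewrite !mxE mulrCA. Qed.

Lemma tensmxDl m n p q (A A' : 'M[C]_(m, n)) (B : 'M[C]_(p, q)) :
  (A + A') *t B = A *t B + A' *t B.
Proof. by apply/matrixP => i j; rewrite !mxE mulrDl. Qed.

Lemma tensmxDr m n p q (A : 'M[C]_(m, n)) (B B' : 'M[C]_(p, q)) :
  A *t (B + B') = A *t B + A *t B'.
Proof. by apply/matrixP => i j; rewrite !mxE mulrDr. Qed.

Lemma eq_tensor n (A B : 'I_n -> 'M[C]_2) : A =1 B -> tensor A = tensor B.
Proof. by move=> /funext ->. Qed.

Lemma tensorM n (A B : 'I_n -> 'M[C]_2) :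
  tensor A *m tensor B = tensor (fun i => A i *m B i).
Proof.
elim: n A B => [|n IHn] A B /=; first by rewrite mulmx1.
by rewrite castmx_sqM tensmx_mul IHn.
Qed.

Lemma tensmx11 m n : (1%:M : 'M[C]_m) *t (1%:M : 'M[C]_n) = 1%:M.
Proof.
apply/matrixP => i j.
case: (mxtens_indexP i) => i0 i1; case: (mxtens_indexP j) => j0 j1.
rewrite tensmxE !mxE (can_eq (@mxtens_indexK _ _)) xpair_eqE.
by rewrite -natrM mulnb.
Qed.

Lemma tensor1 n : tensor (fun _ : 'I_n => 1%:M) = 1%:M :> 'M[C]_(2 ^ n).
Proof.
elim: n => [//|n IHn] /=; rewrite IHn tensmx11.
by case: (2 ^ n.+1)%N / (esym (expnS 2 n)); rewrite castmx_id.
Qed.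

Lemma tensor_adj n (A : 'I_n -> 'M[C]_2) :
  (tensor A)^t* = tensor (fun i => (A i)^t*).
Proof.
elim: n A => [|n IHn] A /=; first by rewrite trmx1 map_mx1.
by rewrite adjmx_cast adjmx_tens IHn.
Qed.

Lemma tensorZ n (c : 'I_n -> C) (A : 'I_n -> 'M[C]_2) :
  tensor (fun i => c i *: A i) = (\prod_i c i) *: tensor A.
Proof.
elim: n c A => [|n IHn] c A /=; first by rewrite big_ord0 scale1r.
by rewrite IHn big_ord_recl tensmxZl tensmxZr scalerA castmxZ.
Qed.

(** Multilinearity in factor [i]: the three families agree at every other factor. *)
Lemma tensorD n (i : 'I_n) (A B D : 'I_n -> 'M[C]_2) :
  D i = A i + B i -> (forall j, j != i -> A j = D j /\ B j = D j) ->
  tensor D = tensor A + tensor B.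
Proof.
elim: n i A B D => [|n IHn] i A B D; first by case: i.
have [j ->|->] := unliftP ord0 i => hi hj /=; rewrite -castmxD; congr castmx.
  have [-> ->] := hj ord0 (neq_lift _ _); rewrite -tensmxDr; congr (_ *t _).
  by apply: (IHn j) => // k kj; apply: hj; rewrite (inj_eq lift_inj).
rewrite hi tensmxDl; congr (_ *t _ + _ *t _); apply: eq_tensor => k.
  by have [|] := hj (lift ord0 k); rewrite // eq_sym neq_lift.
by have [|] := hj (lift ord0 k); rewrite // eq_sym neq_lift.
Qed.

(* X^a Z^b; in particular (true, true) encodes Y = i X Z. *)
Definition pauliXZ (t : bool * bool) : 'M[C]_2 :=
  (if t.1 then pauliX R else 1%:M) *m (if t.2 then pauliZ R else 1%:M).

Lemma mx2P (A B : 'M[C]_2) :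
  A 0 0 = B 0 0 -> A 0 1 = B 0 1 -> A 1 0 = B 1 0 -> A 1 1 = B 1 1 -> A = B.
Proof.
move=> e00 e01 e10 e11; apply/matrixP => i j.
by case: (unliftP ord0 i) => [i'|] ->; case: (unliftP ord0 j) => [j'|] ->;
   rewrite ?(ord1 i') ?(ord1 j'); [move: e11|move: e10|move: e01|move: e00];
   congr (A _ _ = B _ _); apply/val_inj.
Qed.

Lemma pauliXX : pauliX R *m pauliX R = 1%:M.
Proof.
by apply: mx2P; rewrite !mxE !big_ord_recl !big_ord0 !mxE /=; ring.
Qed.

Lemma pauliZZ : pauliZ R *m pauliZ R = 1%:M.
Proof.
by apply: mx2P; rewrite !mxE !big_ord_recl !big_ord0 !mxE /=; ring.
Qed.

Lemma pauliZX : pauliZ R *m pauliX R = - (pauliX R *m pauliZ R).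
Proof.
by apply: mx2P; rewrite !mxE !big_ord_recl !big_ord0 !mxE /=; ring.
Qed.

Lemma pauliYE : pauliY R = 'i *: (pauliX R *m pauliZ R).
Proof.
by apply: mx2P; rewrite !mxE !big_ord_recl !big_ord0 !mxE /=; ring.
Qed.

Lemma pauliX_adj : (pauliX R)^t* = pauliX R.
Proof.
by apply: mx2P; rewrite !mxE /= ?(addr0, add0r) ?conjC0 ?conjC1.
Qed.

Lemma pauliZ_adj : (pauliZ R)^t* = pauliZ R.
Proof.
by apply: mx2P; rewrite !mxE /= ?raddfB /= ?rmorphB /= ?conjC0 ?conjC1.
Qed.


(** The only sign comes from moving the Z of [s] past the X of [t]. *)
Lemma sigmaM s t :
  pauliXZ s *m pauliXZ t =
  (-1) ^+ (s.2 && t.1) *: pauliXZ (s.1 (+) t.1, s.2 (+) t.2).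
Proof.
case: s t => [a b] [a' b']; rewrite /pauliXZ /=.
have -> : (if a (+) a' then pauliX R else 1%:M) =
    (if a then pauliX R else 1%:M) *m (if a' then pauliX R else 1%:M).
  by case: a a' => [] []; rewrite ?pauliXX ?mul1mx ?mulmx1.
have -> : (if b (+) b' then pauliZ R else 1%:M) =
    (if b then pauliZ R else 1%:M) *m (if b' then pauliZ R else 1%:M).
  by case: b b' => [] []; rewrite ?pauliZZ ?mul1mx ?mulmx1.
set Xa := if a then _ else _; set Xa' := if a' then _ else _.
set Zb := if b then _ else _; set Zb' := if b' then _ else _.
have comm : Zb *m Xa' = (-1) ^+ (b && a') *: (Xa' *m Zb).
  rewrite /Zb /Xa'; case: b a' {Zb Xa'} => [] [];
  by rewrite /= ?mul1mx ?mulmx1 ?expr1 ?scaleN1r ?scale1r ?pauliZX.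
by rewrite mulmxA -(mulmxA Xa) comm -scalemxAr -scalemxAl !mulmxA.
Qed.

End Tensor.

(** * Pauli strings up to phase, and the observable Z on one qubit *)

Section PauliStrings.
Variable R : realType.
Local Notation C := R[i].
Local Notation sigma := (@pauliXZ R).
Local Notation Z := (pauliZ R).

Lemma sigma_unitary t : (sigma t)^t* *m sigma t = 1%:M.
Proof.
case: t => a b; rewrite /pauliXZ /= adjmxM.
set Xa := if a then _ else _; set Zb := if b then _ else _.
have XX : Xa^t* *m Xa = 1%:M.
  by rewrite /Xa; case: (a); rewrite ?pauliX_adj ?pauliXX // trmx1 map_mx1
    mulmx1.
have ZZ : Zb^t* *m Zb = 1%:M.
  by rewrite /Zb; case: (b); rewrite ?pauliZ_adj ?pauliZZ // trmx1 map_mx1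
    mulmx1.
by rewrite mulmxA -(mulmxA (Zb^t*)) XX mulmx1.
Qed.

Lemma sign_norm (b : bool) : `|(-1) ^+ b : C| = 1.
Proof. by rewrite normrX normrN1 expr1n. Qed.

Lemma invmxE n (A B : 'M[C]_n) : A *m B = 1%:M -> invmx A = B.
Proof.
by move=> AB; have [uA _] := mulmx1_unit AB; rewrite -[LHS]mulmx1 -AB mulKmx.
Qed.

Lemma pauli1E (A : 'M[C]_2) : pauli1 A ->
  exists (c : C) t, `|c| = 1 /\ A = c *: sigma t.
Proof.
elim=> [||||{}A B _ [c [s [c1 ->]]] _ [d [t [d1 ->]]]|{}A _ [c [t [c1 ->]]]].
- by exists 1, (true, false); rewrite normr1 scale1r /pauliXZ mulmx1.
- by exists 'i, (true, true); rewrite normCi pauliYE.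
- by exists 1, (false, true); rewrite normr1 scale1r /pauliXZ mul1mx.
- by exists 1, (false, false); rewrite normr1 scale1r /pauliXZ mulmx1.
- exists (c * d * (-1) ^+ (s.2 && t.1)), (s.1 (+) t.1, s.2 (+) t.2).
  rewrite !normrM c1 d1 sign_norm !mul1r; split=> //.
  by rewrite -scalemxAl -scalemxAr sigmaM !scalerA.
(* [sigma t] is its own inverse up to this sign, which is -1 exactly for X Z. *)
- exists (c^-1 * (-1) ^+ (t.2 && t.1)), t.
  rewrite normrM normfV c1 sign_norm invr1 mul1r; split=> //.
  apply: invmxE; rewrite -scalemxAl -scalemxAr sigmaM !scalerA !addbb.
  have c0 : c != 0 by rewrite -normr_gt0 c1.
  rewrite mulrA divff // mul1r -expr2 sqrr_sign scale1r.
  by rewrite /pauliXZ mulmx1.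
Qed.

Definition pstring n (t : 'I_n -> bool * bool) : 'M[C]_(2 ^ n) :=
  tensor (fun i => sigma (t i)).

Lemma pstring_unitary n (t : 'I_n -> bool * bool) :
  (pstring t)^t* *m pstring t = 1%:M.
Proof.
rewrite tensor_adj tensorM -[RHS]tensor1; apply: eq_tensor => i.
exact: sigma_unitary.
Qed.

Lemma pauliE n (Q : 'M[C]_(2 ^ n)) : pauli Q ->
  exists (c : C) t, `|c| = 1 /\ Q = c *: pstring t.
Proof.
case=> A hA <-.
pose c i := projT1 (cid (pauli1E (hA i))).
pose t i := projT1 (cid (projT2 (cid (pauli1E (hA i))))).
have ct i : `|c i| = 1 /\ A i = c i *: sigma (t i).
  exact: (projT2 (cid (projT2 (cid (pauli1E (hA i)))))).
exists (\prod_i c i), t; split.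
  by rewrite normr_prod big1 // => i _; case: (ct i).
by rewrite -tensorZ; apply: eq_tensor => i; case: (ct i).
Qed.

Lemma pauliM n (P Q : 'M[C]_(2 ^ n)) : pauli P -> pauli Q -> pauli (P *m Q).
Proof.
case=> A hA <- [B hB <-]; rewrite tensorM; exists (fun i => A i *m B i) => //.
by move=> i; apply: pauli1_M.
Qed.

Definition Zat n (i : 'I_n) : 'M[C]_(2 ^ n) :=
  tensor (fun j => if j == i then Z else 1%:M).

Lemma Zat_pauli n (i : 'I_n) : pauli (Zat i).
Proof.
by exists (fun j => if j == i then Z else 1%:M) => // j; case: eqP => _;
  constructor.
Qed.

Lemma Zat_sqr n (i : 'I_n) : Zat i *m Zat i = 1%:M.
Proof.
rewrite tensorM -[RHS]tensor1; apply: eq_tensor => j.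
by case: eqP => _; rewrite ?pauliZZ ?mulmx1.
Qed.

Lemma Zat_adj n (i : 'I_n) : (Zat i)^t* = Zat i.
Proof.
rewrite tensor_adj; apply: eq_tensor => j.
by case: eqP => _; rewrite ?pauliZ_adj // trmx1 map_mx1.
Qed.

(** Only factor [i] can fail to commute, and it anticommutes with Z exactly when it contains an
    X. *)
Lemma pstring_Zat n (t : 'I_n -> bool * bool) (i : 'I_n) :
  pstring t *m Zat i = (-1) ^+ (t i).1 *: (Zat i *m pstring t).
Proof.
rewrite !tensorM.
transitivity (tensor (fun j => (if j == i then (-1) ^+ (t i).1 else 1 : C) *:
   ((if j == i then Z else 1%:M) *m sigma (t j)))); last first.
  rewrite tensorZ; congr (_ *: _).
  by rewrite (bigD1 i) //= eqxx big1 ?mulr1 // => j /negPf ->.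
apply: eq_tensor => j; case: eqP => [->|_]; last by rewrite mul1mx mulmx1
  scale1r.
have -> : Z = sigma (false, true) by rewrite /pauliXZ mul1mx.
by case: (t i) => [[] []]; rewrite !sigmaM scalerA /= -expr2 ?sqrr_sign ?expr1n.
Qed.

(** The two projectors add up to 1 and differ by Z; solving for each gives the spectral projectors
    of [Zat R i]. *)
Lemma projE n (i : 'I_n) (b : 'I_2) :
  proj R i b = 2^-1 *: (1%:M + (-1) ^+ b *: Zat i).
Proof.
have p01 : proj R i 0 + proj R i 1 = 1%:M.
  rewrite -tensor1; apply/esym/(@tensorD _ _ i) => [|j /negPf -> //].
  rewrite eqxx; apply: mx2P; rewrite !mxE /=; ring.
have p0 : proj R i 0 = Zat i + proj R i 1.
  apply: (@tensorD _ _ i) => [|j /negPf -> //].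
  rewrite eqxx; apply: mx2P; rewrite !mxE /=; ring.
have h : (2 : C) != 0 by rewrite pnatr_eq0.
apply: (scalerI h); rewrite scalerA divff // scale1r.
case: (unliftP ord0 b) => [c ->|->].
  rewrite (ord1 c) expr1 scaleN1r -p01 p0.
  have -> : lift ord0 0 = 1 :> 'I_2 by apply: val_inj.
  by rewrite scaler_nat mulr2n -(addrA (Zat i)) [Zat i + _]addrC addrK.
rewrite expr0 scale1r -p01 scaler_nat mulr2n p0 -!addrA.
by congr (_ + (_ + _)); rewrite addrC.
Qed.

End PauliStrings.

(** * Appending an ancilla to a Kraus operator *)

Section Append.
Variable R : realType.
Local Notation C := R[i].
Local Notation sigma := (@pauliXZ R).

(** [append] for any number of columns, so that the ancilla is absorbed into the Kraus operator
    rather than into the state. *)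
Definition appmx n p (u : 'cV[C]_2) (K : 'M[C]_(2 ^ n, p)) :
  'M[C]_(2 ^ n.+1, p) :=
  castmx (esym (expnS 2 n), mul1n p) (u *t K).

Lemma castmx_mul_cast (T : pzRingType) m n p m' n' p' (e : (m = m') * (n = n'))
    (f : n = n') (g : p = p') (A : 'M[T]_(m, n)) (B : 'M[T]_(n, p)) :
  castmx e A *m castmx (f, g) B = castmx (e.1, g) (A *m B).
Proof.
case: e => em en; case: m' / em; case: p' / g; case: n' / f en => en.
by rewrite !castmx_id.
Qed.

Lemma tensor_appmx n p (A : 'I_n.+1 -> 'M[C]_2) u (K : 'M[C]_(2 ^ n, p)) :
  tensor A *m appmx u K =
  appmx (A ord0 *m u) (tensor (fun j => A (lift ord0 j)) *m K).
Proof. by rewrite /= castmx_mul_cast tensmx_mul. Qed.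

Lemma appmxZl n p c u (K : 'M[C]_(2 ^ n, p)) :
  appmx (c *: u) K = c *: appmx u K.
Proof. by rewrite /appmx tensmxZl castmxZ. Qed.

Lemma appmxZr n p c u (K : 'M[C]_(2 ^ n, p)) :
  appmx u (c *: K) = c *: appmx u K.
Proof. by rewrite /appmx tensmxZr castmxZ. Qed.

Lemma appmxM n p q u (K : 'M[C]_(2 ^ n, p)) (B : 'M_(p, q)) :
  appmx u (K *m B) = appmx u K *m B.
Proof.
have eB : B = castmx (mul1n p, mul1n q) (1%:M *t B).
  by rewrite tens_scalar_mx scale1r castmx_comp castmx_id.
by rewrite [in RHS]eB /appmx castmx_mul_cast tensmx_mul mulmx1.
Qed.

Lemma append_mul n p b (K : 'M[C]_(2 ^ n, p)) (v : 'cV[C]_p) :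
  append b (K *m v) = appmx (ket R b) K *m v.
Proof.
rewrite -appmxM /append /appmx.
by rewrite (eq_irrelevance (mul1n 1) (erefl : (1 * 1 = 1)%N)).
Qed.

Lemma appmx_dot n p q (u v : 'cV[C]_2) (K : 'M[C]_(2 ^ n, p))
  (L : 'M[C]_(2 ^ n, q)) (c : C) :
  u^t* *m v = c%:M -> (appmx u K)^t* *m appmx v L = c *: (K^t* *m L).
Proof.
move=> uv; rewrite adjmx_cast castmx_mul_cast adjmx_tens tensmx_mul uv.
by rewrite tens_scalar_mx castmx_comp castmx_id.
Qed.

Lemma ket_dot b c : (ket R b)^t* *m ket R c = (b == c)%:R%:M.
Proof.
apply/matrixP => i j; rewrite !ord1 mxE (bigD1 b) //= big1 => [|k kb].
  by rewrite !mxE !eqxx /= conjC1 mul1r addr0 mulr1n andbT.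
by rewrite !mxE (negPf kb) /= conjC0 mul0r.
Qed.

Lemma sigma_ketF b s : sigma (false, s) *m ket R b = (-1) ^+ (s && (b == 1)) *:
  ket R b.
Proof.
rewrite /pauliXZ mul1mx /=; case: s => /=; last by rewrite mul1mx scale1r.
rewrite /ket /pauliZ mulmxBl !mul_delta_mx_cond.
by case: (unliftP ord0 b) => [c|] ->; rewrite ?(ord1 c) /=
  ?mulr0n ?mulr1n ?subr0 ?sub0r ?scale1r ?scaleN1r //; congr (- _); congr
    delta_mx; apply: val_inj.
Qed.

(** Z only contributes a sign, and X sends the ket to the other basis ket, which is orthogonal. *)
Lemma sigma_ketT b s : (ket R b)^t* *m (sigma (true, s) *m ket R b) = 0.
Proof.
have -> : sigma (true, s) = pauliX R *m sigma (false, s).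
  by rewrite /pauliXZ /= mul1mx.
rewrite -mulmxA sigma_ketF -!scalemxAr; apply/eqP; rewrite scaler_eq0;
  apply/orP; right.
rewrite /ket /pauliX mulmxDl !mul_delta_mx_cond.
have -> : delta_mx b 0 = ket R b by [].
have [hb|hb] : b = 0 \/ b = 1.
- by case: (unliftP ord0 b) => [c|] ->; [right|left]; rewrite ?(ord1 c); apply:
    val_inj.
- by rewrite hb /= mulr0n mulr1n add0r -/(ket R 1) ket_dot /= raddf0.
- by rewrite hb /= mulr0n mulr1n addr0 -/(ket R 0) ket_dot /= raddf0.
Qed.

End Append.

(** * The six input states and their Pauli expectations *)

Section States.
Variable R : realType.
Local Notation C := R[i].
Local Notation sigma := (@pauliXZ R).
Local Notation Z := (pauliZ R).

Definition ketpm (s : bool) : 'cV[C]_2 := if s then ket_minus R else ket_plus R.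

Lemma ketpmE s : ketpm s = (Num.sqrt (2 : R))^-1%:C *:
  (ket R 0 + (-1) ^+ s *: ket R 1).
Proof. by case: s; rewrite /= ?expr1 ?scaleN1r ?scale1r. Qed.

Lemma ketpm_dot s s' : (ketpm s)^t* *m ketpm s' = (s == s')%:R%:M.
Proof.
rewrite !ketpmE adjmxZ adjmxD adjmxZ -scalemxAl -scalemxAr scalerA.
have -> : (Num.sqrt (2 : R))^-1%:C^* * (Num.sqrt (2 : R))^-1%:C = 2^-1 :> C.
  rewrite mulrC -normCK -add_Re2_Im2 /= expr0n addr0 exprVn sqr_sqrtr ?ler0n //.
  by rewrite fmorphV rmorph_nat.
rewrite mulmxDl !mulmxDr -!scalemxAl -!scalemxAr !ket_dot /=.
rewrite rmorphXn /= rmorphN1.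
apply/matrixP => i j; rewrite !ord1 !mxE /= !mulr1n.
have h : (2 : C) != 0 by rewrite pnatr_eq0.
by case: s s' => [] [] /=; rewrite ?expr0 ?expr1; field.
Qed.

Lemma Z_ketpm s : Z *m ketpm s = ketpm (~~ s).
Proof.
rewrite !ketpmE -scalemxAr mulmxDr -scalemxAr.
have Zk b : Z *m ket R b = (-1) ^+ (b == 1) *: ket R b.
  by have := sigma_ketF R b true; rewrite /pauliXZ mul1mx.
rewrite !Zk /= scale1r scalerA; congr (_ *: (_ + _ *: _)).
by case: s => /=; rewrite ?mulrNN mul1r.
Qed.

(** Z exchanges the orthogonal states |+> and |->, and X then only contributes a sign. *)
Lemma sigma_ketpm a s : (ketpm s)^t* *m (sigma (a, true) *m ketpm s) = 0.
Proof.
rewrite /pauliXZ /= -mulmxA Z_ketpm.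
have ZX : (ketpm s)^t* *m ketpm (~~ s) = 0.
  by rewrite ketpm_dot; case: (s); rewrite raddf0.
case: a; last by rewrite mul1mx.
suff -> : pauliX R *m ketpm (~~ s) = (-1) ^+ (~~ s) *: ketpm (~~ s).
  by rewrite -scalemxAr ZX scaler0.
rewrite !ketpmE -scalemxAr mulmxDr -scalemxAr.
rewrite [RHS]scalerA mulrC -scalerA; congr (_ *: _).
rewrite scalerDr scalerA -expr2 sqrr_sign scale1r addrC.
have X0 : pauliX R *m ket R 0 = ket R 1.
  by rewrite /pauliX /ket mulmxDl !mul_delta_mx_cond /= mulr0n mulr1n add0r.
have X1 : pauliX R *m ket R 1 = ket R 0.
  by rewrite /pauliX /ket mulmxDl !mul_delta_mx_cond /= mulr0n mulr1n addr0.
by rewrite X0 X1.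
Qed.

Definition prod3 (u v w : 'cV[C]_2) : 'cV[C]_(2 ^ 3) := u *t (v *t w).

Lemma tensor_prod3 (A : 'I_3 -> 'M[C]_2) u v w :
  tensor A *m prod3 u v w = prod3 (A 0 *m u) (A 1 *m v) (A 2 *m w).
Proof.
rewrite /prod3 /= !castmx_id tens_mx_scalar castmx_id scale1r.
have e1 : lift ord0 ord0 = 1 :> 'I_3 by apply: val_inj.
have e2 : lift ord0 (lift ord0 ord0) = 2 :> 'I_3 by apply: val_inj.
rewrite e1 e2; rewrite -(tensmx_mul (A 1) (A 2) v w).
exact: (tensmx_mul (A 0) (A 1 *t A 2) u (v *t w)).
Qed.

Lemma prod3_dot u v w u' v' w' :
  (prod3 u v w)^t* *m prod3 u' v' w' =
  (u^t* *m u') *t ((v^t* *m v') *t (w^t* *m w')).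
Proof.
rewrite /prod3 -(tensmx_mul (v^t*) (w^t*) v' w') -adjmx_tens.
have := tensmx_mul (u^t*) ((v *t w)^t*) u' (v' *t w').
by rewrite -adjmx_tens.
Qed.

(** Labels count from 0: [mu %% 3] is the qubit in |+> or |->, and the sign is minus from label 3
    on. *)
Lemma psiE (mu : 'I_6) : psi R mu =
  let k := ketpm (3 <= mu)%N in
  match (mu %% 3)%N with
  | 0 => prod3 k (ket R 1) (ket R 0)
  | 1 => prod3 (ket R 0) k (ket R 1)
  | _ => prod3 (ket R 1) (ket R 0) k
  end.
Proof. by case: mu => [[|[|[|[|[|[|//]]]]]] ?]. Qed.

Lemma psi_norm mu : (psi R mu)^t* *m psi R mu = 1%:M.
Proof.
rewrite psiE; case: (mu %% 3)%N => [|[|?]] /=;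
by rewrite prod3_dot !ket_dot !ketpm_dot !eqxx !tensmx11.
Qed.

Lemma psi_Z (j : 'I_3) : Zat R j *m psi R (inord j) = psi R (inord (j + 3)).
Proof.
rewrite !psiE !inordK ?modnDr; last 2 first.
- by rewrite (@ltn_add2r 3 j 3).
- by rewrite (leq_trans (ltn_ord j)).
rewrite leq_addl leqNgt ltn_ord /=.
by case: j => [[|[|[|//]]] hj]; rewrite /= /Zat tensor_prod3 /= (Z_ketpm false)
  !mul1mx.
Qed.

(** A product state has expectation 0 as soon as one factor does: a Z on the qubit in |+-> or an X
    on a qubit in a basis state is enough. *)
Lemma psi_overlap (mu : 'I_6) (t : 'I_3 -> bool * bool) (j : 'I_3) :
  (if j == inord (mu %% 3) then (t j).2 else (t j).1) ->
  (psi R mu)^t* *m (pstring R t *m psi R mu) = 0.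
Proof.
have mk : (mu %% 3 < 3)%N by rewrite ltn_mod.
rewrite -(inj_eq val_inj) /= inordK // psiE => h.
have sT (k : 'I_3) b : (t k).1 -> (ket R b)^t* *m (sigma (t k) *m ket R b) = 0.
  by case: (t k) => [[] b'] // _; apply: sigma_ketT.
have sU (k : 'I_3) b : (t k).2 -> (ketpm b)^t* *m (sigma (t k) *m ketpm b) = 0.
  by case: (t k) => [a []] // _; apply: sigma_ketpm.
have o0 : Ordinal (isT : (0 < 3)%N) = 0 by apply: val_inj.
have o1 : Ordinal (isT : (1 < 3)%N) = 1 by apply: val_inj.
have o2 : Ordinal (isT : (2 < 3)%N) = 2 by apply: val_inj.
case: (mu %% 3)%N mk h => [|[|[|//]]] _; case: j => [[|[|[|//]]] hj] /=;
rewrite (bool_irrelevance hj isT) ?o0 ?o1 ?o2 => h;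
by rewrite /= /pstring tensor_prod3 prod3_dot ?(sT _ _ h) ?(sU _ _ h)
  ?(tens0mx, tensmx0).
Qed.

(* The states psi mu and psi (mu + 3) have |+-> on qubit mu %% 3, so the third
   case makes the expectation of the Pauli t vanish outside one such pair. *)
Lemma pauli_types (t : 'I_3 -> bool * bool) :
  [\/ forall j, t j = (false, false),
      exists k, forall j, t j = (false, j == k)
    | exists k, forall i, i != k -> exists j, if j == i then (t j).2 else
      (t j).1].
Proof.
have [/existsP[k tk]|] := boolP [exists k, (t k).1].
  (* With an X on qubit [k], only the pair with |+-> on that very qubit escapes. *)
  by apply: Or33; exists k => i ik; exists k; rewrite eq_sym (negPf ik).
rewrite negb_exists => /forallP t1.
have tE j : t j = (false, (t j).2) by case: (t j) (t1 j) => [[]].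
have [/forallP t2|] := boolP [forall j, ~~ (t j).2].
  by apply: Or31 => j; rewrite tE (negPf (t2 j)).
rewrite negb_forall => /existsP[k]; rewrite negbK => tk.
have [/forallP t2|] := boolP [forall j, (j != k) ==> ~~ (t j).2].
  apply: Or32; exists k => j; rewrite tE; have [->|jk] := eqVneq; first by
    rewrite tk.
  by have := t2 j; rewrite jk => /negPf ->.
rewrite negb_forall => /existsP[l]; rewrite negb_imply negbK => /andP[lk tl].
(* With Z on both [k] and [l], the exceptional pair has |+-> on the third qubit [m]. *)
have [m mE] : exists m : 'I_3, forall i, i != m -> i = k \/ i = l.
  case: k l lk {tk tl} => [[|[|[|//]]] ?] [[|[|[|//]]] ?] // _;
  [exists 2|exists 1|exists 2|exists 0|exists 1|exists 0] => -[[|[|[|//]]] ?]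
    //= _;
  by [left; apply: val_inj|right; apply: val_inj].
apply: Or33; exists m => i im; exists i; rewrite eqxx.
by case: (mE i im) => ->.
Qed.

End States.

(** * Probabilities of records and the invariant kept along a run *)

Section Protocol.
Variable R : realType.
Local Notation C := R[i].

Lemma sqfrob_parallelogram m n (A B : 'M[C]_(m, n)) :
  sqfrob (A + B) + sqfrob (A - B) = 2 * (sqfrob A + sqfrob B).
Proof.
rewrite /sqfrob -!big_split mulr_sumr; apply: eq_bigr => i _.
rewrite -!big_split mulr_sumr; apply: eq_bigr => j _.
rewrite !mxE -!add_Re2_Im2 /=; case: (A i j) => a b; case: (B i j) => c d /=;
  ring.
Qed.

Lemma Zat_sqfrob n p i (A : 'M[C]_(2 ^ n, p)) : sqfrob (Zat R i *m A) = sqfrob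
  A.
Proof.
by rewrite (@sqfrob_mul_scalar _ _ _ _ 1) ?mul1r // Zat_adj Zat_sqr.
Qed.

(** By [projE] this is the parallelogram law for [A] and [Zat R i *m A], whose norms agree. *)
Lemma sqfrob_proj n p i (A : 'M[C]_(2 ^ n, p)) :
  \sum_b sqfrob (proj R i b *m A) = sqfrob A.
Proof.
rewrite !big_ord_recl big_ord0 addr0 !projE /= expr0 expr1 scale1r scaleN1r.
rewrite -!scalemxAl !mulmxDl !mul1mx mulNmx !sqfrobZ -mulrDr
  sqfrob_parallelogram Zat_sqfrob.
have -> : complex.Re (`|2^-1 : C| ^+ 2) = 2^-1 ^+ 2.
  by rewrite ger0_norm ?invr_ge0 ?ler0n // -[2]/(2%:R)
    -(rmorph_nat (real_complex R)) -fmorphV -rmorphXn.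
by lra.
Qed.

Lemma record_prob_stop n (v : 'cV[C]_(2 ^ n)) a :
  @record_prob R n (Stop R n) v a = sqfrob v.
Proof. by rewrite /sqfrob /=; apply: eq_bigr => i _; rewrite big_ord1. Qed.

(** [L] is the Kraus operator of the run: the product of its ancilla isometries, unitaries and
    projectors, the same for all inputs. *)
Lemma record_prob_sqfrob n (o : stabop R n) (a : record o) :
  exists m (L : 'M[C]_(m, 2 ^ n)), forall v, record_prob v a = sqfrob (L *m v).
Proof.
elim: o a => {n} [n a|n b o IH a|n V hV o IH a|n i f IH [b a]].
- by exists _, 1%:M => v; rewrite record_prob_stop mul1mx.
- have [m [L hL]] := IH a; exists m, (L *m appmx (ket R b) 1%:M) => v.
  by rewrite -mulmxA -append_mul mul1mx -hL.
- have [m [L hL]] := IH a; exists m, (L *m V) => v.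
  by rewrite -mulmxA -hL.
- have [m [L hL]] := IH b a; exists m, (L *m proj R i b) => v.
  by rewrite -mulmxA -hL.
Qed.

Lemma appmx_ket_isom n p b (K : 'M[C]_(2 ^ n, p)) :
  (appmx (ket R b) K)^t* *m appmx (ket R b) K = K^t* *m K.
Proof. by rewrite (@appmx_dot _ _ _ _ _ _ _ _ 1) ?scale1r // ket_dot eqxx. Qed.

Lemma clifford_adjK n (V : 'M[C]_(2 ^ n)) : clifford V -> V^t* *m V = 1%:M.
Proof.
case=> hV _; apply: mulmx1C; exact/unitarymxP.
Qed.

Lemma record_prob_sum n (o : stabop R n) (v : 'cV[C]_(2 ^ n)) :
  \sum_(a : record o) record_prob v a = sqfrob v.
Proof.
elim: o v => {n} [n v|n b o IH v|n V hV o IH v|n i f IH v].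
- rewrite (eq_bigr (fun=> sqfrob v)) => [|a _]; last exact: record_prob_stop.
  by rewrite sumr_const card_unit.
- rewrite [LHS]IH -{1}[v]mul1mx append_mul (@sqfrob_mul_scalar _ _ _ _ 1)
    ?mul1r //.
  by rewrite appmx_ket_isom trmx1 map_mx1 mulmx1.
- by rewrite [LHS]IH (@sqfrob_mul_scalar _ _ _ _ 1) ?mul1r // clifford_adjK.
- rewrite -(sqfrob_proj i v) -(eq_bigr _ (fun b _ => IH b (proj R i b *m v))).
  by rewrite sig_big_dep /=; apply: eq_bigr => -[].
Qed.

(* The Kraus operators of the runs that reveal nothing about the input: on the
   image of K, each Pauli acts as a Pauli of the input qubits or is uniformly
   random. *)
Definition pauli_preserving n (K : 'M[C]_(2 ^ n, 2 ^ 3)) (w : R) : Prop :=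
  K^t* *m K = w%:C%:M /\
  forall Q, pauli Q ->
    (exists (c : C) t, `|c| = 1 /\ Q *m K = c *: (K *m pstring R t)) \/
    K^t* *m (Q *m K) = 0.

Lemma pauli_preserving1 : pauli_preserving (1%:M : 'M[C]_(2 ^ 3)) 1.
Proof.
split=> [|Q /pauliE[c [t [c1 ->]]]]; first by rewrite trmx1 map_mx1 mulmx1.
by left; exists c, t; rewrite mulmx1 mul1mx.
Qed.

(** Serves for measurements whose projector acts on [K] as a scalar; [d = 0] covers an impossible
    outcome. *)
Lemma pauli_preservingZ n (K : 'M[C]_(2 ^ n, 2 ^ 3)) w (d : C) :
  pauli_preserving K w ->
  pauli_preserving (d *: K) (complex.Re (`|d| ^+ 2) * w).
Proof.
case=> KK hK; split=> [|Q /hK [[c [t [c1 hQ]]]|hQ]].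
- rewrite adjmxZ -scalemxAl -scalemxAr scalerA KK scale_scalar_mx (mulrC _ d)
    -normCK.
  by rewrite -add_Re2_Im2 /= [in RHS]rmorphM.
- left; exists c, t; split=> //.
  by rewrite -scalemxAr hQ -scalemxAl !scalerA mulrC.
- by right; rewrite adjmxZ -scalemxAl -!scalemxAr hQ !scaler0.
Qed.

(** A Pauli with an X on the ancilla has a vanishing compression. Any other acts on the ancilla as a
    phase, and its remaining factors form a Pauli of the old register. *)
Lemma pauli_preserving_append n b (K : 'M[C]_(2 ^ n, 2 ^ 3)) w :
  pauli_preserving K w -> pauli_preserving (appmx (ket R b) K) w.
Proof.
case=> KK hK; split=> [|Q [A hA <-]]; first by rewrite appmx_ket_isom.
rewrite tensor_appmx.
have [c [[[] s] [c1 ->]]] := pauli1E (hA ord0).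
  right; rewrite (@appmx_dot _ _ _ _ _ _ _ _ 0) ?scale0r //.
  by rewrite -scalemxAl -scalemxAr sigma_ketT scaler0 raddf0.
rewrite -scalemxAl sigma_ketF scalerA appmxZl.
have hQ : pauli (tensor (fun j => A (lift ord0 j))) by exists
  (fun j => A (lift ord0 j)).
have [[d [t [d1 ->]]]|h] := hK _ hQ; [left|right].
  exists (c * (-1) ^+ (s && (b == 1)) * d), t; split.
    by rewrite !normrM c1 d1 sign_norm !mulr1.
  by rewrite appmxZr appmxM scalerA.
by rewrite -scalemxAr (@appmx_dot _ _ _ _ _ _ _ _ 1) ?ket_dot ?eqxx // h
  !scaler0.
Qed.

(** Every Pauli has the form [V P V^t*] with [P] a Pauli, and it acts on [V K] as [P] acts on
    [K]. *)
Lemma pauli_preserving_clifford n (V : 'M[C]_(2 ^ n))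
  (K : 'M[C]_(2 ^ n, 2 ^ 3)) w :
  clifford V -> pauli_preserving K w -> pauli_preserving (V *m K) w.
Proof.
move=> hV; have VV := clifford_adjK hV; case: hV => _ hV [KK hK].
split=> [|Q]; first by rewrite adjmxM -mulmxA (mulmxA _ V) VV mul1mx.
rewrite -hV => -[P hP <-].
have e : V *m P *m V^t* *m (V *m K) = V *m (P *m K).
  by rewrite -!mulmxA (mulmxA (V^t*)) VV mul1mx.
rewrite e; have [[c [t [c1 h]]]|h] := hK _ hP; [left|right].
  by exists c, t; rewrite h -scalemxAr mulmxA.
by rewrite adjmxM -mulmxA (mulmxA (V^t*)) VV mul1mx.
Qed.

End Protocol.

(** * Measurements with a random outcome, and measurements of an input Pauli *)

Section PauliMeasurement.
Variable R : realType.
Local Notation C := R[i].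

Lemma sqfrob_psi mu : sqfrob (psi R mu) = 1.
Proof. by rewrite sqfrobE_adj psi_norm mxtrace1. Qed.

Lemma pauli_preserving_psi n (K : 'M[C]_(2 ^ n, 2 ^ 3)) w mu :
  pauli_preserving K w -> sqfrob (K *m psi R mu) = w.
Proof. by case=> KK _; rewrite (sqfrob_mul_scalar _ KK) sqfrob_psi mulr1. Qed.

Lemma pauli_preserving_sqfrob n (K : 'M[C]_(2 ^ n, 2 ^ 3)) w :
  pauli_preserving K w -> sqfrob K = 8 * w.
Proof.
case=> KK _; rewrite sqfrobE_adj KK mxtrace_scalar raddfMn /= mulr_natl; exact:
  erefl.
Qed.

Lemma proj_adj n i b : (proj R (n := n) i b)^t* = proj R i b.
Proof.
rewrite tensor_adj; apply: eq_tensor => j; case: eqP => _; last by rewrite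
  trmx1 map_mx1.
by rewrite trmx_delta map_delta_mx.
Qed.

Lemma proj_Zat n (i : 'I_n) b : proj R i b *m Zat R i = (-1) ^+ b *: proj R i b.
Proof.
rewrite projE -scalemxAl mulmxDl mul1mx -scalemxAl Zat_sqr.
rewrite scalerA mulrC -scalerA; congr (_ *: _).
by rewrite scalerDr scalerA -expr2 sqrr_sign scale1r addrC.
Qed.

Lemma proj_idem n (i : 'I_n) b : proj R i b *m proj R i b = proj R i b.
Proof.
rewrite {2}projE -scalemxAr mulmxDr mulmx1 -scalemxAr proj_Zat scalerA -expr2
  sqrr_sign scale1r.
have h : (2 : C) != 0 by rewrite pnatr_eq0.
by rewrite -mulr2n -(scaler_nat 2 (proj R i b)) scalerA mulVf // scale1r.
Qed.

(** Z has mean 0 on every input, so both outcomes get half the weight. The Paulis are then treated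
    according to whether they commute with the measured Z. *)
Lemma pauli_preserving_split n (K : 'M[C]_(2 ^ n, 2 ^ 3)) w i b :
  pauli_preserving K w -> K^t* *m (Zat R i *m K) = 0 ->
  pauli_preserving (proj R i b *m K) (w / 2).
Proof.
move=> [KK hK] KZK.
have pE p (B : 'M_(_, p)) : proj R i b *m B = 2^-1 *:
  (B + (-1) ^+ b *: (Zat R i *m B)).
  by rewrite projE -scalemxAl mulmxDl mul1mx scalemxAl.
have KpB p (B : 'M_(_, p)) : (proj R i b *m K)^t* *m B = K^t* *m
  (proj R i b *m B).
  by rewrite adjmxM proj_adj mulmxA.
split=> [|Q hQ].
  rewrite KpB (mulmxA (proj R i b)) proj_idem pE -scalemxAr mulmxDr -scalemxAr
    KZK.
  by rewrite scaler0 addr0 KK scale_scalar_mx [in RHS]rmorphM /= fmorphV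
    rmorph_nat mulrC.
have [c [t [c1 hQt]]] := pauliE hQ.
have QZ : Q *m Zat R i = (-1) ^+ (t i).1 *: (Zat R i *m Q).
  by rewrite hQt -scalemxAl -scalemxAr pstring_Zat !scalerA mulrC.
have [ti|ti] := boolP (t i).1.
  (* An anticommuting [Q] maps the range of the projector to that of the complementary one, so its
     compression vanishes. *)
  right; rewrite KpB; rewrite ti expr1 scaleN1r in QZ.
  have -> : Q *m (proj R i b *m K) = Q *m K - proj R i b *m (Q *m K).
    rewrite !mulmxA -mulmxBl; congr (_ *m _).
    rewrite projE -scalemxAr mulmxDr mulmx1 -scalemxAr QZ -scalemxAl mulmxDl
      mul1mx -scalemxAl.
    have h : (2 : C) != 0 by rewrite pnatr_eq0.
    apply: (scalerI h); rewrite scalerBr !scalerA divff // !scale1r.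
    by rewrite scaler_nat mulr2n opprD addrACA subrr add0r scalerN.
  by rewrite mulmxBr (mulmxA (proj R i b) (proj R i b)) proj_idem subrr mulmx0.
rewrite (negPf ti) scale1r in QZ.
have Qp : Q *m proj R i b = proj R i b *m Q.
  by rewrite projE -scalemxAr mulmxDr mulmx1 -scalemxAr QZ -scalemxAl mulmxDl
    mul1mx -scalemxAl.
have QpK : Q *m (proj R i b *m K) = proj R i b *m (Q *m K) by rewrite !mulmxA
  Qp.
rewrite QpK; have [[d [s [d1 ->]]]|h1] := hK _ hQ.
  by left; exists d, s; rewrite -scalemxAr mulmxA.
(* After the projection Z is the sign [(-1) ^+ b], so [Q] may be replaced by [Q Z]; if that is
   random on [K] too, both terms of the compression vanish. *)
have [[d [s [d1 h2]]]|h2] := hK _ (pauliM hQ (Zat_pauli R i)).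
  left; exists ((-1) ^+ b * d), s; split; first by rewrite normrM normrX
    normrN1 expr1n mul1r.
  have -> : proj R i b *m (Q *m K) = (-1) ^+ b *:
    (proj R i b *m (Q *m Zat R i *m K)).
    rewrite QZ -mulmxA (mulmxA _ (Zat R i)) proj_Zat -scalemxAl scalerA -expr2.
    by rewrite sqrr_sign scale1r.
  by rewrite h2 -scalemxAr scalerA mulmxA.
right; rewrite KpB (mulmxA (proj R i b)) proj_idem pE -scalemxAr mulmxDr h1
  -scalemxAr.
by rewrite (mulmxA (Zat R i)) -QZ h2 scaler0 addr0 scaler0.
Qed.

(** The coefficients depend on [t] alone, so the bound can be summed over records whatever the
    guesses. For a [K] of weight [w] the norms are [8 * w] for [K] and [w] for each state, hence the
    total [5 * w]. *)
Lemma pauli_eigen_bound (t : 'I_3 -> bool * bool) :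
  ~ (forall j, t j = (false, false)) ->
  exists (beta : R) (alpha : 'I_6 -> R), beta * 8 + \sum_nu alpha nu = 5 /\
  forall m (A : 'M[C]_(m, 2 ^ 3)) (c : C) (b : bool), `|c| = 1 ->
    c *: (A *m pstring R t) = (-1) ^+ b *: A ->
  forall mu, sqfrob (A *m psi R mu) <=
    beta * sqfrob A + \sum_nu alpha nu * sqfrob (A *m psi R nu).
Proof.
have swap m (A : 'M[C]_(m, 2 ^ 3)) (c : C) (b : bool) (v : 'cV_(2 ^ 3)) : `|c|
  = 1 ->
    c *: (A *m pstring R t) = (-1) ^+ b *: A ->
    sqfrob (A *m (pstring R t *m v)) = sqfrob (A *m v).
  move=> c1 h; rewrite mulmxA -(sqfrobZ1 _ c1) scalemxAl h -scalemxAl sqfrobZ1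
    //.
  exact: sign_norm.
case: (pauli_types t) => [//|[k tk] _|[k tk] _].
  (* [x] is the state with |-> on qubit [k]; Z exchanges it with state [k], so the other five states
     suffice. *)
  pose x : 'I_6 := inord (k + 3).
  have xE : x = (k + 3)%N :> nat by rewrite inordK // (@ltn_add2r 3 k 3).
  exists 0, (fun nu => (nu != x)%:R); split.
    rewrite mul0r add0r (bigD1 x) //= eqxx add0r.
    rewrite (eq_bigr (fun=> 1)) => [|nu ->] //.
    by rewrite sumr_const cardC1 card_ord.
  move=> m A c b c1 h mu; rewrite mul0r add0r.
  have main nu : nu != x ->
      sqfrob (A *m psi R nu) <= \sum_nu (nu != x)%:R * sqfrob (A *m psi R nu).
    move=> nx; rewrite [leRHS](bigD1 nu) //= nx mul1r lerDl.
    by apply: sumr_ge0 => ? _; rewrite mulr_ge0 ?ler0n ?sqfrob_ge0.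
  have [->|] := eqVneq mu x; last exact: main.
  rewrite /x -psi_Z.
  have -> : Zat R k = pstring R t.
    by apply: eq_tensor => j; rewrite tk /pauliXZ /= mul1mx.
  rewrite (swap _ _ _ _ _ c1 h); apply: main.
  rewrite -(inj_eq val_inj) /= xE inordK; last by rewrite
    (leq_trans (ltn_ord k)).
  by rewrite -[X in X != _]addn0 eqn_add2l.
(* Half the operator norm, plus half of each state of the exceptional pair: 4 + 1 = 5. *)
exists 2^-1, (fun nu => (nu %% 3 == k)%N%:R / 2); split.
  rewrite !big_ord_recl big_ord0 /=.
  by case: k {tk} => [[|[|[|//]]] ?] /=; lra.
move=> m A c b c1 h mu.
have F0 : 0 <= sqfrob A by apply: sqfrob_ge0.
(* For a state of the exceptional pair, its probability is at most its average with [sqfrob A]. *)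
have [mk|mk] := eqVneq (mu %% 3)%N k.
  rewrite (bigD1 mu) //= mk eqxx mulr1n.
  have := bessel A (psi_norm R mu).
  set S := \sum_(_ < _ | _) _.
  have : 0 <= S by apply: sumr_ge0 => ? _; rewrite !mulr_ge0 ?ler0n ?sqfrob_ge0
    ?invr_ge0.
  by lra.
have [|j hj] := tk (inord (mu %% 3)).
  by rewrite -(inj_eq val_inj) /= inordK // ltn_mod.
have : sqfrob (A *m psi R mu) + sqfrob (A *m (pstring R t *m psi R mu)) <=
  sqfrob A.
  apply: (bessel2 _ (psi_norm R mu) _ (psi_overlap R hj)).
  by rewrite adjmxM mulmxA -(mulmxA _ (_^t*)) pstring_unitary mulmx1 psi_norm.
rewrite (swap _ _ _ _ _ c1 h).
set S := \sum_(_ < _) _.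
have : 0 <= S by apply: sumr_ge0 => ? _; rewrite !mulr_ge0 ?ler0n ?sqfrob_ge0
  ?invr_ge0.
by lra.
Qed.

End PauliMeasurement.

(** * Induction over the protocol *)

Section GuessBound.
Variable R : realType.
Local Notation C := R[i].

(** [sqfrob K] is [8 * w], so at most [5 * w] of the total weight [6 * w] is guessed. Stated through
    [sqfrob K], the bound adds up over the outcomes of a measurement. *)
Lemma sum_guess_le n (o : stabop R n) (K : 'M[C]_(2 ^ n, 2 ^ 3)) w
  (g : record o -> 'I_6) :
  pauli_preserving K w ->
  \sum_(a : record o) record_prob (K *m psi R (g a)) a <= 5 / 8 * sqfrob K.
Proof.
elim: o K w g => {n}
  [n K w g hK|n b o IH K w g hK|n V hV o IH K w g hK|n i f IH K w g hK].
- rewrite (eq_bigr (fun=> w)) => [|a _]; last first.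
    by rewrite record_prob_stop (pauli_preserving_psi _ hK).
  rewrite sumr_const card_unit (pauli_preserving_sqfrob hK).
  by have := sqfrob_ge0 K; rewrite (pauli_preserving_sqfrob hK); lra.
- have -> : sqfrob K = sqfrob (appmx (ket R b) K) by rewrite !sqfrobE_adj
    appmx_ket_isom.
  apply: le_trans (IH _ _ g (pauli_preserving_append b hK)).
  by rewrite le_eqVlt; apply/orP; left; apply/eqP; apply: eq_bigr => a _;
    rewrite -append_mul.
- have -> : sqfrob K = sqfrob (V *m K).
    by rewrite (@sqfrob_mul_scalar _ _ _ _ 1) ?mul1r // clifford_adjK.
  apply: le_trans (IH _ _ g (pauli_preserving_clifford hV hK)).
  by rewrite le_eqVlt; apply/orP; left; apply/eqP; apply: eq_bigr => a _;
    rewrite -mulmxA.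
have -> : \sum_(a : record (Measure i f)) record_prob (K *m psi R (g a)) a =
    \sum_b \sum_(a : record (f b))
      record_prob
        (proj R i b *m K *m psi R (g (Tagged (fun b => record (f b)) a))) a.
  by rewrite sig_big_dep /=; apply: eq_bigr => -[b a] _ /=; rewrite mulmxA.
(* Handles the measurements that reveal nothing: the induction hypothesis applies after each
   outcome. *)
have branches : (forall b, exists w', pauli_preserving (proj R i b *m K) w') ->
    \sum_b \sum_(a : record (f b))
      record_prob
        (proj R i b *m K *m psi R (g (Tagged (fun b => record (f b)) a))) a
    <= 5 / 8 * sqfrob K.
  move=> hb; rewrite -(sqfrob_proj i K) mulr_sumr; apply: ler_sum => b _.
  by have [w' hw'] := hb b; apply: IH hw'.
have [[c [t [c1 ZK]]]|KZK] := hK.2 _ (Zat_pauli R i); last first.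
  by apply: branches => b; exists (w / 2); apply: pauli_preserving_split.
have [/forallP t0|/forallP t0] := boolP [forall j, t j == (false, false)].
  apply: branches => b; have t1 : pstring R t = 1%:M.
    rewrite -tensor1; apply: eq_tensor => j.
    by rewrite (eqP (t0 j)) /pauliXZ mulmx1.
  have -> : proj R i b *m K = (2^-1 * (1 + (-1) ^+ b * c)) *: K.
    rewrite projE -scalemxAl mulmxDl mul1mx -scalemxAl ZK t1 mulmx1.
    by rewrite -scalerA scalerDl scale1r scalerA.
  by eexists; apply: pauli_preservingZ hK.
have [|beta [alpha [ab5 bound]]] := @pauli_eigen_bound R t.
  by move=> h; apply: t0 => j; rewrite h.
(* First revealing measurement: the induction hypothesis gives way to a bound record by record. The
   norm of [K] is spread over basis inputs so that each term becomes a sum over records. *)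
apply: (@le_trans _ _
  (beta * (\sum_x sqfrob (K *m delta_mx x 0 : 'cV_(2 ^ n))) +
    \sum_nu alpha nu * sqfrob (K *m psi R nu))); last first.
  rewrite -sqfrob_cols (pauli_preserving_sqfrob hK).
  rewrite (eq_bigr (fun nu => alpha nu * w)) => [|nu _]; last first.
    by rewrite (pauli_preserving_psi _ hK).
  rewrite -mulr_suml; have -> : \sum_nu alpha nu = 5 - beta * 8 by rewrite -ab5
    addrC addKr.
  lra.
have sumE v : sqfrob (K *m v) = \sum_b \sum_(a : record (f b)) record_prob
  (proj R i b *m K *m v) a.
  by rewrite -(sqfrob_proj i); apply: eq_bigr => b _; rewrite record_prob_sum
    mulmxA.
rewrite (eq_bigr _ (fun x _ => sumE _)) exchange_big mulr_sumr.
rewrite [X in _ <= _ + X](eq_bigr (fun nu => \sum_b \sum_(a : record (f b))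
  alpha nu * record_prob (proj R i b *m K *m psi R nu) a)) => [|nu _]; last
    first.
  by rewrite sumE mulr_sumr; apply: eq_bigr => b _; rewrite mulr_sumr.
rewrite [X in _ <= _ + X]exchange_big -big_split; apply: ler_sum => b _.
rewrite [X in _ <= _ * X + _]exchange_big mulr_sumr
  [X in _ <= _ + X]exchange_big -big_split.
apply: ler_sum => a _ /=.
have [m [L hL]] := record_prob_sqfrob a.
pose A := L *m (proj R i b *m K).
have AE v : record_prob (proj R i b *m K *m v) a = sqfrob (A *m v).
  by rewrite hL /A !mulmxA.
rewrite AE (eq_bigr _ (fun x _ => AE _)) -sqfrob_cols
  (eq_bigr (fun nu => alpha nu * sqfrob (A *m psi R nu))) => [|nu _]; last by
  rewrite AE.
apply: (bound _ _ c (b == 1)) => //.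
(* The projector turns Z into the sign of the outcome, while [ZK] turns it into the input Pauli
   [t]. *)
transitivity (L *m (proj R i b *m (Zat R i *m K))).
  by rewrite ZK /A -!scalemxAr !mulmxA.
rewrite (mulmxA (proj R i b)) proj_Zat -scalemxAl -scalemxAr.
by congr (_ ^+ _ *: _); case: (b) => [[|[|//]] ?].
Qed.

End GuessBound.

(** * Hellman and Raviv's inequality *)

Section Entropy.
Variable R : realType.

Lemma ln_sub_le (a b : R) : 0 < a -> 0 < b -> b * (ln a - ln b) <= a - b.
Proof.
move=> a0 b0; rewrite -ln_div ?posrE //.
have -> : a / b = 1 + (a / b - 1) by rewrite addrC subrK.
have h : -1 < a / b - 1 by rewrite ltrBrDr addNr divr_gt0.
apply: le_trans (ler_wpM2l (ltW b0) (le_ln1Dx h)) _.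
by rewrite mulrBr mulrCA divff ?mulr1 // gt_eqF.
Qed.

Lemma ln2_gt0 : 0 < ln 2 :> R.
Proof. by rewrite ln_gt0 // ltr1n. Qed.

Lemma ln2_le1 : ln 2 <= 1 :> R.
Proof. by have := @ln_sub_le 2 1 (ltr0n _ 2) ltr01; rewrite ln1; lra. Qed.

Lemma log2_halving (p s : R) : 0 <= p -> 2 * p <= s -> p <= p *
  (log2 s - log2 p).
Proof.
rewrite le_eqVlt => /predU1P[<-|p0] ps; first by rewrite mul0r.
rewrite ler_peMr ?(ltW p0) // /log2 -mulrBl ler_pdivlMr ?ln2_gt0 // mul1r.
rewrite lerBrDr -lnM ?posrE //; rewrite ler_ln ?posrE // ?mulr_gt0 //; lra.
Qed.

(** Concavity: [log2] lies above its chord between [m] and [2 * m]. The tangent bounds at [s] for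
    these endpoints are combined with weights [2 * m - s] and [s - m], which cancel the right-hand
    sides. *)
Lemma log2_large_max (m s : R) : 0 < m -> m <= s -> s <= 2 * m ->
  s - m <= m * (log2 s - log2 m).
Proof.
move=> m0 ms sm; have s0 : 0 < s by lra.
rewrite /log2 -mulrBl mulrA ler_pdivlMr ?ln2_gt0 //.
have h1 := ln_sub_le m0 s0.
have h2 : s * (ln 2 + ln m - ln s) <= 2 * m - s.
  by rewrite -lnM ?posrE //; apply: ln_sub_le; rewrite // mulr_gt0.
rewrite -(ler_pM2l s0).
have k1 : (2 * m - s) * (s * (ln m - ln s)) <= (2 * m - s) * (m - s).
  by apply: ler_wpM2l h1; lra.
have k2 : (s - m) * (s * (ln 2 + ln m - ln s)) <= (s - m) * (2 * m - s).
  by apply: ler_wpM2l h2; lra.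
by move: k1 k2; nra.
Qed.

(** The tangent bound at [s], taken at [2 * m], leaves a slack of [(s - 2 * m) * (1 - ln 2)],
    nonnegative since [ln 2 <= 1]. *)
Lemma log2_small_max (m s : R) : 0 < m -> 2 * m < s ->
  2 * (s - m) <= s * (log2 s - log2 m).
Proof.
move=> m0 ms; have s0 : 0 < s by lra.
rewrite /log2 -mulrBl mulrA ler_pdivlMr ?ln2_gt0 //.
have h : s * (ln 2 + ln m - ln s) <= 2 * m - s.
  by rewrite -lnM ?posrE //; apply: ln_sub_le; rewrite // mulr_gt0.
have k : (s - 2 * m) * ln 2 <= (s - 2 * m) * 1.
  by apply: ler_wpM2l ln2_le1; lra.
by move: h k; nra.
Qed.

(** The inequality for one unnormalized distribution. If the maximum is below half the sum, every
    logarithm is bounded through it; otherwise the maximum and the remaining terms each contribute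
    [s - p m]. *)
Lemma entropy_defect_ge (S : finType) (p : S -> R) (m : S) :
  (forall i, 0 <= p i) -> (forall i, p i <= p m) ->
  2 * (\sum_i p i - p m) <=
  (\sum_i p i) * log2 (\sum_i p i) - \sum_i p i * log2 (p i).
Proof.
move=> p0 pm; set s := \sum_i p i.
have sE : s = p m + \sum_(i | i != m) p i by rewrite /s (bigD1 m).
have r0 : 0 <= \sum_(i | i != m) p i by apply: sumr_ge0.
rewrite {2}/s mulr_suml -sumrB
  (eq_bigr (fun i => p i * (log2 s - log2 (p i)))); last first.
  by move=> i _; rewrite mulrBr.
have [pm0|pm0] := eqVneq (p m) 0.
  have pz i : p i = 0 by apply/le_anti; rewrite p0 -pm0 pm.
  by rewrite big1 => [|i _]; rewrite ?pz ?mul0r // /s big1 ?subrr ?mulr0.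
have {}pm0 : 0 < p m by rewrite lt_def pm0 p0.
have [ms|sm] := ltP (2 * p m) s.
  apply: le_trans (log2_small_max pm0 ms) _; rewrite {1}/s mulr_suml.
  apply: ler_sum => i _; have [->|pi0] := eqVneq (p i) 0; first by rewrite
    !mul0r.
  have {}pi0 : 0 < p i by rewrite lt_def pi0 p0.
  rewrite ler_pM2l // lerD2l lerN2 /log2 ler_pM2r ?invr_gt0 ?ln2_gt0 //.
  by rewrite ler_ln ?posrE.
rewrite (bigD1 m) //=.
have h1 : s - p m <= p m * (log2 s - log2 (p m)).
  by apply: log2_large_max => //; lra.
(* Each such [p i] is at most both [p m] and [s - p m], hence at most half of [s]. *)
have h2 : \sum_(i | i != m) p i <= \sum_(i | i != m) p i *
  (log2 s - log2 (p i)).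
  apply: ler_sum => i im; apply: log2_halving => //.
  have : p i <= \sum_(i | i != m) p i.
    by rewrite (bigD1 i) //= lerDl sumr_ge0.
  by have := pm i; lra.
by lra.
Qed.

(** By the chain rule the conditional entropy is a sum over [t] of the defects bounded above; [g]
    picks a most likely value for each [t]. *)
Lemma cond_entropy_guess (S T : finType) (p : S * T -> R) (g : T -> S) :
  (forall x, 0 <= p x) -> (forall s t, p (s, t) <= p (g t, t)) ->
  2 * (\sum_t marginal2 p t - \sum_t p (g t, t)) <= cond_entropy p.
Proof.
move=> p0 pg.
have -> : cond_entropy p = entropy p - entropy (marginal2 p).
  by rewrite /cond_entropy /mutual_info; lra.
rewrite /entropy opprK [leRHS]addrC.
have -> : \sum_x p x * log2 (p x) = \sum_t \sum_s p (s, t) * log2 (p (s, t)).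
  by rewrite exchange_big pair_big; apply: eq_bigr => -[].
rewrite -!sumrB mulr_sumr; apply: ler_sum => t _.
by apply: (@entropy_defect_ge _ (fun s => p (s, t))).
Qed.

End Entropy.

(** * From the guessing bound to mutual information *)

Lemma psuccE (R : realType) (o : stabop R 3) (g : record o -> 'I_6) :
  psucc o g = \sum_a joint o (g a, a).
Proof.
rewrite /psucc
  -(pair_big_dep xpredT (fun mu a => g a == mu) (fun mu a => joint o (mu, a)))
  /=.
rewrite (exchange_big_dep xpredT) //=; apply: eq_bigr => a _.
by rewrite (big_pred1 (g a)) // => mu; rewrite /= eq_sym.
Qed.

(** The run starts from the identity, of weight 1 and squared norm 8, and the prior is 1/6. *)
Lemma psucc_le (R : realType) (o : stabop R 3) (g : record o -> 'I_6) :
  psucc o g <= 5 / 6.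
Proof.
have := sum_guess_le g (pauli_preserving1 R).
rewrite (pauli_preserving_sqfrob (pauli_preserving1 R)) psuccE -mulr_sumr.
under eq_bigr do rewrite mul1mx.
by lra.
Qed.

Theorem mainTheorem5 (R : realType) (o : stabop R 3) :
  [/\ mutual_info (joint o) <= log2 6 - 1 / 3,
      1 / 3 <= cond_entropy (joint o)
    & forall g : record o -> 'I_6, psucc o g < 9603 / 10000].
Proof.
have joint_ge0 x : 0 <= joint o x.
  have [m [L hL]] := record_prob_sqfrob x.2.
  by rewrite /joint hL mulr_ge0 ?sqfrob_ge0 // invr_ge0 ler0n.
have m1 mu : marginal1 (joint o) mu = 6^-1.
  by rewrite /marginal1 -mulr_sumr record_prob_sum sqfrob_psi mulr1.
have e1 : entropy (marginal1 (joint o)) = log2 6.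
  rewrite /entropy (eq_bigr (fun=> 6^-1 * log2 6^-1)) => [|mu _]; last by
    rewrite m1.
  rewrite sumr_const card_ord /log2 lnV ?posrE ?ltr0n //.
  by rewrite -mulr_natl; field; rewrite gt_eqF // ln2_gt0.
have m2 : \sum_a marginal2 (joint o) a = 1.
  rewrite exchange_big (eq_bigr (fun=> 6^-1)) => [|mu _]; last exact: m1.
  by rewrite sumr_const card_ord -[LHS]mulr_natl divff // pnatr_eq0.
pose g (a : record o) := [arg max_(mu > (ord0 : 'I_6)) joint o (mu, a)]%O.
have gmax mu a : joint o (mu, a) <= joint o (g a, a).
  by rewrite /g; case: arg_maxP => // nu _; apply.
(* The constant is 2 (1 - 5/6), with [g] the most likely label given the record. *)
have ce : 1 / 3 <= cond_entropy (joint o).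
  apply: le_trans (cond_entropy_guess joint_ge0 gmax).
  by rewrite m2 -psuccE; have := psucc_le g; lra.
(* 5/6 is already below 0.9603. *)
split=> // [|h]; last by apply: le_lt_trans (psucc_le h) _; lra.
by move: ce; rewrite /cond_entropy e1; lra.
Qed.
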